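(* For every $X\in 2^{\omega}$ the following are equivalent: (a) $X$ is Kurtz random; (b) for every $Y\in 2^{\omega}$ and every truth-table reduction $\Phi$ with $\Phi^Y=X$, there is a constant $c$ such that for all $n$ the $Y$-use of $\Phi$ in the computation of $X\restriction_n$ is at least $n-c$.
   Context: $X\restriction_n$ is the first $n$ bits of $X$. A truth-table reduction is a Turing functional $\Phi$ that is total on every oracle; equivalently, for each $i$ one computes a truth-table (a Boolean condition on finitely many oracle positions) determining $\Phi^Z(i)$ for all oracles $Z$. Its oracle-use at $i$ is the largest position of the oracle occurring in the truth-table for $i$ (a computable function independent of the oracle); the use for computing $X\restriction_n$ is one more than the maximum of these over $i<n$. A Kurtz test is a uniformly computable sequence $(D_i)$ of finite sets of binary strings such that the Lebesgue measure of the set of reals with a prefix in $D_i$ is at most $2^{-i}$; $X$ is Kurtz random if there is no Kurtz test with $X$ having a prefix in every $D_i$. *)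

(* Defs.v *)
From mathcomp Require Import all_boot all_order all_algebra.
From mathcomp Require Import all_classical all_reals all_analysis.
From mathcomp Require Import lra zify.

Set Implicit Arguments.
Unset Strict Implicit.
Unset Printing Implicit Defensive.

Import Order.TTheory GRing.Theory Num.Theory.

Local Open Scope classical_set_scope.
Local Open Scope ring_scope.

(* Programs for the partial (mu-)recursive functions, indexed by arity. *)
Inductive partrec : nat -> Type :=
| PRzero n : partrec n
| PRsucc : partrec 1
| PRproj n : 'I_n -> partrec n
| PRcomp k n : partrec k -> ('I_k -> partrec n) -> partrec n
| PRrec n : partrec n -> partrec n.+2 -> partrec n.+1
| PRmin n : partrec n.+1 -> partrec n.

(* [pr_eval f v y]: program f halts on input v with output y.
   PRrec f g is the h such that h(0, v) = f(v) and
   h(m + 1, v) = g(m, h(m, v), v);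
   PRmin f maps v to the least y with f(y, v) = 0, all the values f(z, v) for
   z < y being required to be defined (and nonzero). *)
Fixpoint pr_eval n (f : partrec n) : n.-tuple nat -> nat -> Prop :=
  match f in partrec n return n.-tuple nat -> nat -> Prop with
  | PRzero _ => fun _ y => y = 0%N
  | PRsucc => fun v y => y = (thead v).+1
  | PRproj _ i => fun v y => y = tnth v i
  | PRcomp k _ g h => fun v y =>
      exists2 w : k.-tuple nat,
        forall j, pr_eval (h j) v (tnth w j) & pr_eval g w y
  | PRrec n g h => fun v =>
      let u : n.-tuple nat := [tuple of behead v] in
      (fix iter m y : Prop :=
         if m is m'.+1 then
           exists2 z, iter m' z & pr_eval h [tuple of m' :: z :: u] y
         else pr_eval g u y) (thead v)
  | PRmin _ g => fun v y =>
      pr_eval g [tuple of y :: v] 0%N /\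
      (forall z, (z < y)%N -> exists x, pr_eval g [tuple of z :: v] x.+1)
  end.

Lemma pr_eval_det n (f : partrec n) v y y' :
  pr_eval f v y -> pr_eval f v y' -> y = y'.
Proof.
elim: f v y y' => {n} [n|//=|n i|k n g IHg h IHh|n g IHg h IHh|n g IHg] v y y' /=.
- by move=> -> ->.
- by move=> -> ->.
- by move=> -> ->.
- move=> [w hw gw] [w' hw' gw']; suff e : w = w' by subst w'; exact: IHg gw gw'.
  by apply: eq_from_tnth => j; exact: IHh (hw j) (hw' j).
- elim: (thead v) y y' => [|m IHm] y y'; first exact: IHg.
  by move=> [z hz gz] [z' hz' gz']; have e := IHm _ _ hz hz'; subst z'; exact: IHh gz gz'.
- move=> [h1 h2] [h1' h2']; have [lt|lt|//] := ltngtP y y'.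
    by have [x hx] := h2' _ lt; have := IHg _ _ _ h1 hx.
  by have [x hx] := h2 _ lt; have := IHg _ _ _ h1' hx.
Qed.

Definition computable (f : nat -> nat) : Prop :=
  exists p : partrec 1, forall x, pr_eval p [tuple x] (f x).

(* Effective numberings of binary strings and of finite lists of binary strings,
   built on the bijection CodeSeq.code : seq nat -> nat. *)
Definition code_string (s : bitseq) : nat := CodeSeq.code (map nat_of_bool s).

Definition code_strings (D : seq bitseq) : nat :=
  CodeSeq.code (map code_string D).

Definition prefix_of (X : nat -> bool) (n : nat) : bitseq := mkseq X n.

Definition has_prefix_in (X : nat -> bool) (D : seq bitseq) : Prop :=
  exists n, prefix_of X n \in D.

(* Lebesgue measure on 2^omega: the pushforward of Lebesgue measure on [0, 1[
   along the binary expansion (ending in infinitely many zeros for dyadic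
   rationals).  Lemma cantor_lebesgue_cylinder below shows that the set of reals
   extending a string s gets measure 2^-|s|. *)
Definition binary_digits {R : realType} (x : R) : nat -> bool :=
  fun i => odd (Num.truncn (x * 2 ^+ i.+1)).

Definition cantor_lebesgue (R : realType) (A : set (nat -> bool)) : \bar R :=
  lebesgue_measure (`[0, 1[ `&` binary_digits @^-1` A : set R).

Definition bits_val (s : bitseq) : nat :=
  foldl (fun a (b : bool) => b + a.*2)%N 0%N s.

Lemma ltn_bits_val s : (bits_val s < 2 ^ size s)%N.
Proof.
elim/last_ind: s => // s b; rewrite /bits_val foldl_rcons size_rcons expnS.
by case: b => ?; lia.
Qed.

Lemma truncn_double (R : realType) (x : R) (n : nat) : 0 <= x ->
  (Num.truncn (x * 2 ^+ n.+1))./2 = Num.truncn (x * 2 ^+ n).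
Proof.
move=> x0; have y0 : 0 <= x * 2 ^+ n by rewrite mulr_ge0// exprn_ge0.
have z0 : 0 <= x * 2 ^+ n.+1 by rewrite mulr_ge0// exprn_ge0.
apply/esym/truncn_def; have /andP[h1 h2] := truncn_itv z0.
set t := Num.truncn _ in h1 h2 *; move: h1 h2; rewrite exprS mulrCA => h1 h2.
have h3 : (t./2.*2 <= t)%N by lia.
have h4 : (t.+1 <= t./2.+1.*2)%N by lia.
move: h3 h4; rewrite -!(ler_nat R) -!muln2 !natrM => h3 h4; lra.
Qed.

Lemma prefix_of_binary_digits (R : realType) (x : R) (s : bitseq) :
  0 <= x < 1 ->
  prefix_of (binary_digits x) (size s) = s <->
  Num.truncn (x * 2 ^+ size s) = bits_val s.
Proof.
move=> /andP[x0 x1]; elim/last_ind: s => [|s b IH].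
  split=> // _; rewrite /= expr0 mulr1; apply: truncn_def; rewrite x0 x1//.
rewrite /prefix_of size_rcons mkseqS /bits_val foldl_rcons -/(bits_val s).
have e := truncn_double (size s) x0.
split.
  move/rcons_inj => [/IH h <-]; rewrite -h -e /binary_digits.
  exact/esym/odd_double_half.
move=> h; congr rcons.
  by apply/IH; rewrite -e h half_bit_double.
by rewrite /binary_digits h oddD odd_double addbF oddb.
Qed.

Lemma cantor_lebesgue_cylinder (R : realType) (s : bitseq) :
  cantor_lebesgue R [set X | prefix_of X (size s) = s] = (2 ^- size s)%:E.
Proof.
set n := size s; set v := bits_val s.
have p0 : (0 : R) < 2 ^+ n by rewrite exprn_gt0.
rewrite /cantor_lebesgue.
have -> : `[0, 1[ `&` binary_digits @^-1` [set X | prefix_of X n = s] =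
    `[v%:R / 2 ^+ n, v.+1%:R / 2 ^+ n[%classic :> set R.
  apply/seteqP; split => x /=; rewrite !in_itv /=.
    move=> [x01 /(prefix_of_binary_digits _ x01) h].
    have /andP[x0 _] := x01; rewrite ler_pdivrMr// ltr_pdivlMr//.
    by rewrite /v -h; apply: truncn_itv; rewrite mulr_ge0// ltW.
  rewrite ler_pdivrMr// ltr_pdivlMr// => h.
  have x01 : 0 <= x < 1.
    move/andP: h => [h1 h2]; rewrite -(pmulr_lge0 _ p0).
    rewrite (le_trans _ h1) ?ler0n //= -(ltr_pM2r p0) mul1r (lt_le_trans h2)//.
    by rewrite -natrX ler_nat ltn_bits_val.
  by split=> //; apply/prefix_of_binary_digits => //; exact: truncn_def.
rewrite lebesgue_measure_itv /= lte_fin ltr_pM2r ?invr_gt0// ltr_nat ltnSn.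
by rewrite -EFinD -mulrBl -natrB// subSnn mul1r.
Qed.

(* The finite set D i is given by a list of its elements. *)
Definition kurtz_test (R : realType) (D : nat -> seq bitseq) : Prop :=
  computable (fun i => code_strings (D i)) /\
  forall i, (cantor_lebesgue R [set X | has_prefix_in X (D i)]
             <= (2 ^- i)%:E)%E.

Definition kurtz_random (R : realType) (X : nat -> bool) : Prop :=
  ~ exists D, kurtz_test R D /\ forall i, has_prefix_in X (D i).

(* A truth table: the list of the queried oracle positions, and the list of the
   rows (sequences of answers to these queries) on which its value is true. *)
Record truth_table := TruthTable {
  tt_queries : seq nat;
  tt_rows : seq bitseq
}.

Definition tt_value (t : truth_table) (Z : nat -> bool) : bool :=
  map Z (tt_queries t) \in tt_rows t.

Definition code_tt (t : truth_table) : nat :=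
  CodeSeq.code [:: CodeSeq.code (tt_queries t); code_strings (tt_rows t)].

Record tt_reduction := TTReduction {
  tt_table :> nat -> truth_table;
  tt_computable : computable (fun i => code_tt (tt_table i))
}.

Definition tt_apply (Phi : tt_reduction) (Z : nat -> bool) : nat -> bool :=
  fun i => tt_value (Phi i) Z.

(* 0 if the truth table for i queries no position. *)
Definition tt_use_at (Phi : tt_reduction) (i : nat) : nat :=
  (\max_(p <- tt_queries (Phi i)) p)%N.

Definition tt_use (Phi : tt_reduction) (n : nat) : nat :=
  (\max_(i < n) tt_use_at Phi i)%N.+1.

(* Main.v *)
(* (a) => (b): if the use of Phi drops below n - c for every c, let N c be the
   least n witnessing this. The strings Phi^z|_(N c), z ranging over all strings
   of length the use, form a set of measure at most 2^-c which catches X; the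
   sequence is computable because N is found by search.

   (b) => (a): given a Kurtz test (D i) catching X, the strings of length
   i + l i extending a member of D i, l i large, are at most 2^(l i) many, so
   that X|_(i + l i) can be named by l i bits, given i. Let Y be a concatenation
   of blocks, the k-th block naming X|_(i_k + l i_k) in this way. Since the
   start u_k of the block is computable from D, we may take i_k = u_k + k + 1,
   and then the first u_(k+1) = u_k + l i_k bits of Y determine
   X|_(u_(k+1) + k + 1) by a truth-table reduction. *)
Require Import Defs.
From mathcomp Require Import all_boot all_order all_algebra.
From mathcomp Require Import all_classical all_reals all_analysis.
From mathcomp Require Import zify.

Set Implicit Arguments.
Unset Strict Implicit.
Unset Printing Implicit Defensive.

(** * Closure properties of the recursive functions *)

Definition recursive n (f : n.-tuple nat -> nat) : Prop :=
  exists p : partrec n, forall v, pr_eval p v (f v).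

Definition recursive2 (f : nat -> nat -> nat) : Prop :=
  exists p : partrec 2, forall x y, pr_eval p [tuple x; y] (f x y).

Lemma recursive1P f : computable f <-> recursive (fun v : 1.-tuple nat => f (thead v)).
Proof.
split=> -[p Hp]; exists p => v; last by have := Hp [tuple v]; rewrite theadE.
by case/tupleP: v => x w; rewrite [w]tuple0 theadE; exact: Hp.
Qed.

Lemma recursive_proj n (i : 'I_n) : recursive (fun v => tnth v i).
Proof. by exists (PRproj i). Qed.

Lemma recursive_comp1 n g (f : n.-tuple nat -> nat) :
  computable g -> recursive f -> recursive (fun v => g (f v)).
Proof.
move=> [pg Hg] [pf Hf]; exists (PRcomp pg (fun=> pf)) => v /=.
by exists [tuple f v] => // j; rewrite (ord1 j).
Qed.

Lemma recursive_comp2 n g (f1 f2 : n.-tuple nat -> nat) :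
  recursive2 g -> recursive f1 -> recursive f2 ->
  recursive (fun v => g (f1 v) (f2 v)).
Proof.
move=> [pg Hg] [p1 H1] [p2 H2].
exists (PRcomp pg (fun j : 'I_2 => if j == ord0 then p1 else p2)) => v /=.
exists [tuple f1 v; f2 v]; last exact: Hg.
by case=> -[|[|//]] i; [exact: H1|exact: H2].
Qed.

Lemma computable_ext f g : f =1 g -> computable f -> computable g.
Proof. by move=> e [p Hp]; exists p => x; rewrite -e. Qed.

Lemma computable_id : computable id.
Proof. by exists (PRproj ord0). Qed.

Lemma computable_comp g f : computable g -> computable f -> computable (g \o f).
Proof. by move=> cg /recursive1P cf; apply/recursive1P; exact: (recursive_comp1 cg cf). Qed.

Lemma computable_comp2 g f1 f2 :
  recursive2 g -> computable f1 -> computable f2 ->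
  computable (fun x => g (f1 x) (f2 x)).
Proof.
move=> cg /recursive1P c1 /recursive1P c2.
by apply/recursive1P; exact: (recursive_comp2 cg c1 c2).
Qed.

Lemma computable_succ : computable S.
Proof. by exists PRsucc. Qed.

Lemma computable_cst k : computable (fun=> k).
Proof.
elim: k => [|k IH]; first by exists (PRzero 1).
exact: (computable_comp computable_succ IH).
Qed.

Lemma recursive2_comp1 g f :
  computable g -> recursive2 f -> recursive2 (fun x y => g (f x y)).
Proof.
move=> [pg Hg] [p Hp]; exists (PRcomp pg (fun=> p)) => x y /=.
by exists [tuple f x y] => // j; rewrite (ord1 j).
Qed.

Lemma recursive2_comp g f1 f2 :
  recursive2 g -> recursive2 f1 -> recursive2 f2 ->
  recursive2 (fun x y => g (f1 x y) (f2 x y)).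
Proof.
move=> [pg Hg] [p1 H1] [p2 H2].
exists (PRcomp pg (fun j : 'I_2 => if j == ord0 then p1 else p2)) => x y /=.
exists [tuple f1 x y; f2 x y]; last exact: Hg.
by case=> -[|[|//]] i; [exact: H1|exact: H2].
Qed.

Lemma recursive2_l f : computable f -> recursive2 (fun x _ => f x).
Proof.
move=> cf; have [p Hp] := recursive_comp1 cf (@recursive_proj 2 ord0).
by exists p => x y; exact: Hp.
Qed.

Lemma recursive2_r f : computable f -> recursive2 (fun _ y => f y).
Proof.
move=> cf; have [p Hp] := recursive_comp1 cf (@recursive_proj 2 ord_max).
by exists p => x y; exact: Hp.
Qed.

(** Reduces the evaluation of [PRrec] to two checks on an explicit sequence of values [r], so that
    the tuple casts in [pr_eval] are handled only once. *)
Lemma pr_eval_rec n (g : partrec n) (h : partrec n.+2) u (r : nat -> nat) :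
  pr_eval g u (r 0) ->
  (forall m, pr_eval h [tuple of m :: r m :: u] (r m.+1)) ->
  forall m, pr_eval (PRrec g h) [tuple of m :: u] (r m).
Proof.
(* The inner recursion with its parameter tuple abstracted: the tuple occurring in [pr_eval] equals
   [u] only up to [val_inj]. *)
move=> H0 HS m; pose rec_graph w := fix iter m y : Prop :=
  if m is m'.+1 then exists2 z, iter m' z & pr_eval h [tuple of m' :: z :: w] y
  else pr_eval g w y.
suff : rec_graph [tuple of behead [tuple of m :: u]] m (r m) by [].
have -> : [tuple of behead [tuple of m :: u]] = u by exact: val_inj.
by elim: m => [|m IH] //=; exists (r m).
Qed.

Lemma computable_min g f : recursive2 g -> (forall x, g (f x) x = 0) ->
  (forall x y, (y < f x)%N -> (0 < g y x)%N) -> computable f.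
Proof.
move=> [p Hp] g0 gS; exists (PRmin p) => x /=; split=> [|y /gS].
  by have := Hp (f x) x; rewrite g0.
by move=> gyx; exists (g y x).-1; have := Hp y x; rewrite -{1}(prednK gyx).
Qed.

Lemma computable_nat_iteri h k :
  recursive2 h -> computable (fun m => iteri m h k).
Proof.
(* Here [PRrec] needs a base program of arity 0, obtained by composing a constant program with the
   nullary zero. *)
have [p0 Hp0] : exists p : partrec 0, forall v, pr_eval p v k.
  have [p Hp] := computable_cst k.
  exists (PRcomp p (fun=> PRzero 0)) => v /=; exists [tuple 0] => // j.
  by rewrite (ord1 j).
move=> [p Hp]; exists (PRrec p0 p).
by apply: (pr_eval_rec (r := fun m => iteri m h k)) => // m; exact: Hp.
Qed.

Lemma recursive2_iter f : computable f -> recursive2 (fun m x => iter m f x).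
Proof.
(* The step program receives [m], the previous value and [x]; position 1 is the value to iterate
   on. *)
move=> cf; have [p Hp] := recursive_comp1 cf (@recursive_proj 3 (@Ordinal 3 1 isT)).
exists (PRrec (PRproj ord0) p) => m x.
by apply: (pr_eval_rec (r := fun m => iter m f x)) => // {}m; exact: Hp.
Qed.

Lemma recursive2_swap f : recursive2 f -> recursive2 (fun x y => f y x).
Proof.
move=> cf.
have [p Hp] := recursive_comp2 cf (@recursive_proj 2 ord_max) (@recursive_proj 2 ord0).
by exists p => x y; exact: Hp.
Qed.

Lemma recursive2_ext f g : f =2 g -> recursive2 f -> recursive2 g.
Proof. by move=> e [p Hp]; exists p => x y; rewrite -e. Qed.

Lemma recursive2_add : recursive2 addn.
Proof.
by apply: recursive2_ext (recursive2_iter computable_succ) => m x; rewrite iter_succn addnC.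
Qed.

Lemma computable_pred : computable predn.
Proof.
apply: computable_ext (computable_nat_iteri 0 (recursive2_l computable_id)).
by case.
Qed.

Lemma recursive2_sub : recursive2 subn.
Proof.
apply: recursive2_ext (recursive2_swap (recursive2_iter computable_pred)) => m x.
by rewrite iter_predn.
Qed.

(** By the recursion [(n.+1)./2 = n - n./2]. *)
Lemma computable_half : computable half.
Proof.
apply: computable_ext (computable_nat_iteri 0 recursive2_sub).
by elim=> //= n ->; lia.
Qed.

Lemma computable_double : computable double.
Proof.
apply: computable_ext (computable_comp2 recursive2_add computable_id computable_id) => n.
exact: addnn.
Qed.

Lemma computable_odd : computable odd.
Proof.
apply: computable_ext (computable_comp2 recursive2_sub computable_id
  (computable_comp computable_double computable_half)) => n /=; lia.
Qed.

Lemma computable_sg : computable (fun n => (0 < n)%N).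
Proof.
apply: computable_ext (computable_comp2 recursive2_sub (computable_cst 1)
  (computable_comp2 recursive2_sub (computable_cst 1) computable_id)) => n /=; lia.
Qed.

(** * Head and tail of a coded list *)

(* [CodeSeq.code] is a bijection [seq nat -> nat] with code (a :: s) = 2^a (2 code s + 1),
   so the head of a list is the 2-adic valuation of its code. *)
Definition code_cons (a b : nat) : nat := iter a double b.*2.+1.
Definition code_behead (z : nat) : nat := (iter (logn 2 z) half z)./2.

Lemma code_consE a s : CodeSeq.code (a :: s) = code_cons a (CodeSeq.code s).
Proof.
rewrite /code_cons /=; elim: a => [|a /= <-]; first by rewrite mul1n.
by rewrite expnS -mulnA mul2n.
Qed.

Lemma iter_half_code_cons a b : iter a half (code_cons a b) = b.*2.+1.
Proof.
by rewrite /code_cons; elim: a => //= a IH; rewrite -iterS iterSr /= doubleK.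
Qed.

Lemma code_cons_gt0 a b : (0 < code_cons a b)%N.
Proof. by rewrite /code_cons; elim: a => //= a; rewrite double_gt0. Qed.

Lemma logn_code_cons a b : logn 2 (code_cons a b) = a.
Proof.
elim: a => [|a IH]; first by rewrite /code_cons lognE /= dvdn2 /= odd_double.
have -> : code_cons a.+1 b = (2 * code_cons a b)%N by rewrite mul2n.
by rewrite lognM ?code_cons_gt0// IH.
Qed.

Lemma code_cons_behead a b : code_behead (code_cons a b) = b.
Proof. by rewrite /code_behead logn_code_cons iter_half_code_cons; lia. Qed.

Lemma recursive2_code_cons : recursive2 code_cons.
Proof.
apply: (recursive2_comp (recursive2_iter computable_double) (recursive2_l computable_id)).
apply: (@recursive2_r (S \o double)).
exact: computable_comp computable_succ computable_double.
Qed.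

Lemma iter_half y z : iter y half z = (z %/ 2 ^ y)%N.
Proof. by elim: y => [|y IH]; rewrite ?divn1//= IH -divn2 -divnMA expnS mulnC. Qed.

(** The valuation of [z > 0] is the least [y] with [z %/ 2 ^ y] odd. The guard [0 < x] stops the
    search at 0 when [z = 0], in accordance with [logn 2 0 = 0]. *)
Lemma computable_logn2 : computable (logn 2).
Proof.
apply: (@computable_min (fun y x => ((0 < x) - odd (iter y half x))%N)).
- apply: recursive2_comp recursive2_sub (recursive2_r computable_sg) _.
  exact: recursive2_comp1 computable_odd (recursive2_iter computable_half).
- move=> z; rewrite iter_half; have [//|z0] := posnP z.
  suff -> : odd (z %/ 2 ^ logn 2 z) by [].
  rewrite -[odd _]negbK -dvdn2 -p'natE// -p_part -[z in (z %/ _)%N](partnC 2 z0).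
  by rewrite mulKn ?part_gt0// part_pnat.
- move=> z y; rewrite iter_half; have [->|z0 ylt] := posnP z; first by rewrite logn0.
  suff -> : odd (z %/ 2 ^ y) = false by [].
  apply/negbTE; rewrite -dvdn2 dvdn_divRL ?pfactor_dvdn//; last exact: ltnW.
  by rewrite -expnS pfactor_dvdn.
Qed.

Lemma computable_code_behead : computable code_behead.
Proof.
apply: (@computable_comp half) computable_half _.
exact: computable_comp2 (recursive2_iter computable_half) computable_logn2 computable_id.
Qed.

(** * Computable functions between coded types *)

(** This is [CodeSeq.code [:: a; b]], the form in which [code_tt] packs its two components. *)
Definition code_pair (a b : nat) : nat := code_cons a (code_cons b 0).

Lemma recursive2_code_pair : recursive2 code_pair.
Proof.
apply: (recursive2_comp recursive2_code_cons (recursive2_l computable_id)).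
apply: recursive2_r.
exact: (computable_comp2 recursive2_code_cons computable_id (computable_cst 0)).
Qed.

Lemma computable_iteri h n b : computable h -> computable n -> computable b ->
  computable (fun x => iteri (n x) (fun i a => h (code_pair (code_pair x i) a)) (b x)).
Proof.
move=> ch cn [pb Hb].
pose r m x := iteri m (fun i a => h (code_pair (code_pair x i) a)) (b x).
suff cr : recursive2 r by exact: (computable_comp2 cr cn computable_id).
(* [PRrec] supplies the index, the accumulator and [x] in this order, while [h] expects [x], the
   index and the accumulator. *)
pose i0 := @Ordinal 3 0 isT; pose i1 := @Ordinal 3 1 isT; pose i2 := @Ordinal 3 2 isT.
have [ph Hh] := recursive_comp1 ch (recursive_comp2 recursive2_code_pair
  (recursive_comp2 recursive2_code_pair (recursive_proj i2) (recursive_proj i0))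
  (recursive_proj i1)).
exists (PRrec pb ph) => m x.
by apply: (pr_eval_rec (r := r^~ x)) => [|{}m]; [exact: Hb|exact: Hh].
Qed.

(** Branching is an iteration of length 0 or 1 that starts at [g x]; the step recovers [x] from the
    nested pair by taking heads twice. *)
Lemma computable_if b f g : computable b -> computable f -> computable g ->
  computable (fun x => if b x is _.+1 then f x else g x).
Proof.
move=> cb cf cg.
have cp := computable_logn2.
apply: computable_ext (computable_iteri (computable_comp cf (computable_comp cp cp))
  (computable_comp computable_sg cb) cg) => x /=.
by case: (b x) => //= n; rewrite !logn_code_cons.
Qed.

Lemma if_code_cons T a b (x y : T) : (if code_cons a b is _.+1 then x else y) = x.
Proof. by move: (code_cons_gt0 a b); case: (code_cons a b). Qed.

(** Canonical encodings let computability be proved for functions on pairs and lists directly. On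
    [bitseq] and [seq bitseq] they agree with [code_string] and [code_strings]. *)
Structure codedType := CodedType { coded_sort :> Type; encode : coded_sort -> nat }.
Arguments encode {c} _ : simpl never.

Canonical coded_nat := CodedType (id : nat -> nat).
Canonical coded_bool := CodedType nat_of_bool.
Canonical coded_pair (A B : codedType) :=
  CodedType (fun p : A * B => CodeSeq.code [:: encode p.1; encode p.2]).
Canonical coded_seq (A : codedType) :=
  CodedType (fun s : seq A => CodeSeq.code (map encode s)).

Lemma encode_pair (A B : codedType) (p : A * B) :
  encode p = code_pair (encode p.1) (encode p.2).
Proof. by rewrite /code_pair -[0]/(CodeSeq.code [::]) -!code_consE. Qed.

Lemma encode_cons (A : codedType) a (s : seq A) :
  encode (a :: s) = code_cons (encode a) (encode s).
Proof. exact: code_consE. Qed.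

Lemma encode_seq_inj (A : codedType) : injective (@encode A) -> injective (@encode (coded_seq A)).
Proof. by move=> injA s t /(can_inj CodeSeq.codeK)/(inj_map injA). Qed.

Lemma encode_bitseq_inj : injective (encode : bitseq -> nat).
Proof. by apply: encode_seq_inj => -[] []. Qed.

(** The function [g] tracks [f] on codes and is arbitrary on numbers that are not codes. *)
Definition cfun (A B : codedType) (f : A -> B) : Prop :=
  exists2 g, computable g & forall a, encode (f a) = g (encode a).

Definition cfun2 (A B C : codedType) (f : A -> B -> C) : Prop :=
  cfun (fun p => f p.1 p.2).

Definition cfun3 (A B C D : codedType) (f : A -> B -> C -> D) : Prop :=
  cfun (fun p => f p.1.1 p.1.2 p.2).

Lemma cfun_ext (A B : codedType) (f g : A -> B) : f =1 g -> cfun f -> cfun g.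
Proof. by move=> e [h ch hE]; exists h => // a; rewrite -e hE. Qed.

Lemma cfun_id (A : codedType) : cfun (fun x : A => x).
Proof. by exists id => //; exact: computable_id. Qed.

Lemma cfun_cst (A B : codedType) (b : B) : cfun (fun _ : A => b).
Proof. by exists (fun=> encode b) => //; exact: computable_cst. Qed.

Lemma cfun_comp (G A B : codedType) (f : A -> B) (g : G -> A) :
  cfun f -> cfun g -> cfun (fun x => f (g x)).
Proof.
move=> [f' cf fE] [g' cg gE]; exists (f' \o g'); first exact: computable_comp.
by move=> x; rewrite fE gE.
Qed.

Lemma cfun_pair (G A B : codedType) (f : G -> A) (g : G -> B) :
  cfun f -> cfun g -> cfun (fun x => (f x, g x)).
Proof.
move=> [f' cf fE] [g' cg gE]; exists (fun x => code_pair (f' x) (g' x)).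
  exact: (computable_comp2 recursive2_code_pair cf cg).
by move=> x; rewrite encode_pair fE gE.
Qed.

Lemma cfun_fst (G A B : codedType) (f : G -> A * B) : cfun f -> cfun (fun x => (f x).1).
Proof.
move=> [f' cf fE]; exists (logn 2 \o f').
  exact: computable_comp computable_logn2 cf.
by move=> x /=; rewrite -fE encode_pair logn_code_cons.
Qed.

Lemma cfun_snd (G A B : codedType) (f : G -> A * B) : cfun f -> cfun (fun x => (f x).2).
Proof.
move=> [f' cf fE]; exists (logn 2 \o (code_behead \o f')).
  exact: computable_comp computable_logn2 (computable_comp computable_code_behead cf).
by move=> x /=; rewrite -fE encode_pair code_cons_behead logn_code_cons.
Qed.

Lemma cfun_app2 (G A B C : codedType) (f : A -> B -> C) (g : G -> A) (h : G -> B) :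
  cfun2 f -> cfun g -> cfun h -> cfun (fun x => f (g x) (h x)).
Proof. by move=> cf cg ch; exact: (cfun_comp cf (cfun_pair cg ch)). Qed.

Lemma cfun_app3 (G A B C D : codedType) (f : A -> B -> C -> D)
  (g : G -> A) (h : G -> B) (k : G -> C) :
  cfun3 f -> cfun g -> cfun h -> cfun k -> cfun (fun x => f (g x) (h x) (k x)).
Proof. by move=> cf cg ch ck; exact: (cfun_comp cf (cfun_pair (cfun_pair cg ch) ck)). Qed.

Lemma cfun_recursive2 (G : codedType) (f : nat -> nat -> nat) (g h : G -> nat) :
  recursive2 f -> cfun g -> cfun h -> cfun (fun x => f (g x) (h x)).
Proof.
move=> cf [g' cg gE] [h' ch hE]; exists (fun x => f (g' x) (h' x)).
  exact: computable_comp2.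
by move=> x; rewrite -gE -hE.
Qed.

Lemma cfun_iteri (G A : codedType) (h : G -> nat -> A -> A) (n : G -> nat) (b : G -> A) :
  cfun3 h -> cfun n -> cfun b -> cfun (fun x => iteri (n x) (h x) (b x)).
Proof.
move=> [h' ch hE] [n' cn nE] [b' cb bE].
eexists; first exact: (computable_iteri ch cn cb).
move=> x /=; rewrite -nE -[encode (n x)]/(n x).
elim: (n x) => //= m IH.
by rewrite -IH (hE (x, m, _)) !encode_pair.
Qed.

Lemma cfun_case (G A B : codedType) (F : G -> A -> seq A -> B) (g : G -> B) (l : G -> seq A) :
  cfun3 F -> cfun g -> cfun l ->
  cfun (fun x => if l x is a :: s then F x a s else g x).
Proof.
move=> [F' cF FE] [g' cg gE] [l' cl lE].
have cpair := @computable_comp2 _ _ _ recursive2_code_pair.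
eexists.
  apply: (computable_if cl (computable_comp cF (cpair _ _ (cpair _ _ computable_id
    (computable_comp computable_logn2 cl)) (computable_comp computable_code_behead cl))) cg).
move=> x; rewrite /comp -lE; case: (l x) => [//|a s].
rewrite encode_cons if_code_cons logn_code_cons code_cons_behead.
by rewrite (FE (x, a, s)) !encode_pair.
Qed.

(** Makes the code of a list a computable bound on the number of steps needed to consume it. *)
Lemma leq_size_encode (A : codedType) (s : seq A) : (size s <= encode s)%N.
Proof.
elim: s => //= a s IH; rewrite encode_cons /code_cons.
apply: (@leq_trans (encode s).*2.+1); first by lia.
by elim: (encode a) => //= n; lia.
Qed.

(** The state consists of the accumulator and the unread part of the list; it is stationary once
    that part is empty, so any sufficiently large number of steps will do. *)
Lemma foldl_iter (A B : Type) (h : B -> A -> B) n b s : (size s <= n)%N ->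
  foldl h b s =
  (iter n (fun p : B * seq A => if p.2 is a :: t then (h p.1 a, t) else p) (b, s)).1.
Proof.
elim: n b s => [|n IH] b [|a s] //; rewrite iterSr /=; last exact: IH.
by move=> _; rewrite -IH.
Qed.

Lemma iteri_cst (A : Type) n (f : A -> A) x : iteri n (fun=> f) x = iter n f x.
Proof. by elim: n => //= n ->. Qed.

Lemma cfun_iter (G A : codedType) (h : G -> A -> A) (n : G -> nat) (b : G -> A) :
  cfun2 h -> cfun n -> cfun b -> cfun (fun x => iter (n x) (h x) (b x)).
Proof.
move=> ch cn cb.
apply: (@cfun_ext _ _ (fun x => iteri (n x) (fun=> h x) (b x))).
  by move=> x; exact: iteri_cst.
apply: cfun_iteri => //.
exact: (cfun_app2 ch (cfun_fst (cfun_fst (cfun_id _))) (cfun_snd (cfun_id _))).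
Qed.

Lemma cfun_cons (G A : codedType) (f : G -> A) (g : G -> seq A) :
  cfun f -> cfun g -> cfun (fun x => f x :: g x).
Proof.
move=> [f' cf fE] [g' cg gE]; exists (fun x => code_cons (f' x) (g' x)).
  exact: (computable_comp2 recursive2_code_cons cf cg).
by move=> x; rewrite encode_cons fE gE.
Qed.

Lemma cfun_encode (G A : codedType) (f : G -> A) : cfun f -> cfun (fun x => encode (f x)).
Proof. by move=> [f' cf fE]; exists f'. Qed.

Lemma cfun_foldl (G A B : codedType) (h : G -> B -> A -> B) (b : G -> B) (l : G -> seq A) :
  cfun3 h -> cfun b -> cfun l -> cfun (fun x => foldl (h x) (b x) (l x)).
Proof.
move=> ch cb cl.
pose step x (p : B * seq A) := if p.2 is a :: t then (h x p.1 a, t) else p.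
apply: (@cfun_ext _ _ (fun x => (iter (encode (l x)) (step x) (b x, l x)).1)).
  by move=> x; apply/esym/foldl_iter; exact: leq_size_encode.
apply: cfun_fst; apply: cfun_iter; [|exact: cfun_encode|exact: cfun_pair].
apply: (cfun_case (F := fun (p : G * (B * seq A)) a s => (h p.1 p.2.1 a, s))).
- apply: cfun_pair; last exact: cfun_snd (cfun_id _).
  have c1 := cfun_fst (cfun_fst (cfun_id (G * (B * seq A) * A * seq A)%type)).
  exact: (cfun_app3 ch (cfun_fst c1) (cfun_fst (cfun_snd c1))
    (cfun_snd (cfun_fst (cfun_id _)))).
- exact: cfun_snd (cfun_id _).
- exact: cfun_snd (cfun_snd (cfun_id _)).
Qed.

Lemma cfun_rev (G A : codedType) (l : G -> seq A) : cfun l -> cfun (fun x => rev (l x)).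
Proof.
move=> cl.
apply: (@cfun_ext _ _ (fun x => foldl (fun s a => a :: s) [::] (l x))).
  by move=> x; rewrite /rev; elim: (l x) [::] => //=.
apply: cfun_foldl => //; last exact: cfun_cst.
exact: cfun_cons (cfun_snd (cfun_id _)) (cfun_snd (cfun_fst (cfun_id _))).
Qed.

Lemma cfun_foldr (G A B : codedType) (h : G -> A -> B -> B) (b : G -> B) (l : G -> seq A) :
  cfun3 h -> cfun b -> cfun l -> cfun (fun x => foldr (h x) (b x) (l x)).
Proof.
move=> ch cb cl.
apply: (@cfun_ext _ _ (fun x => foldl (fun z a => h x a z) (b x) (rev (l x)))).
  by move=> x; rewrite foldl_rev.
apply: cfun_foldl => //; last exact: cfun_rev.
have c1 := cfun_fst (cfun_id (G * B * A)%type).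
exact: (cfun_app3 ch (cfun_fst c1) (cfun_snd (cfun_id _)) (cfun_snd c1)).
Qed.

Lemma cfun_nat_of_bool (G : codedType) (b : G -> bool) :
  cfun b -> cfun (fun x => nat_of_bool (b x)).
Proof. exact: cfun_encode. Qed.

Lemma cfun_if (G A : codedType) (b : G -> bool) (f g : G -> A) :
  cfun b -> cfun f -> cfun g -> cfun (fun x => if b x then f x else g x).
Proof.
move=> cb cf cg.
apply: (@cfun_ext _ _ (fun x => iter (b x) (fun=> f x) (g x))).
  by move=> x; case: (b x).
apply: cfun_iter; [|exact: cfun_nat_of_bool|by []].
exact: (cfun_comp cf (cfun_fst (cfun_id _))).
Qed.

Lemma cfun_andb (G : codedType) (b c : G -> bool) :
  cfun b -> cfun c -> cfun (fun x => b x && c x).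
Proof. by move=> cb cc; exact: (cfun_if cb cc (cfun_cst _ false)). Qed.

Lemma cfun_orb (G : codedType) (b c : G -> bool) :
  cfun b -> cfun c -> cfun (fun x => b x || c x).
Proof. by move=> cb cc; exact: (cfun_if cb (cfun_cst _ true) cc). Qed.

Lemma cfun_add (G : codedType) (f g : G -> nat) :
  cfun f -> cfun g -> cfun (fun x => (f x + g x)%N).
Proof. exact: cfun_recursive2 recursive2_add. Qed.

Lemma cfun_sub (G : codedType) (f g : G -> nat) :
  cfun f -> cfun g -> cfun (fun x => (f x - g x)%N).
Proof. exact: cfun_recursive2 recursive2_sub. Qed.

Lemma cfun_succ (G : codedType) (f : G -> nat) : cfun f -> cfun (fun x => (f x).+1).
Proof.
move=> [f' cf fE]; exists (S \o f'); first exact: computable_comp computable_succ cf.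
by move=> x; rewrite /= -fE.
Qed.

Lemma cfun_leq (G : codedType) (f g : G -> nat) :
  cfun f -> cfun g -> cfun (fun x => (f x <= g x)%N).
Proof.
move=> cf cg.
have [h ch hE] := cfun_sub (cfun_cst _ 1) (cfun_sub cf cg).
by exists h => // x; rewrite -hE /encode /=; lia.
Qed.

Lemma cfun_eqn (G : codedType) (f g : G -> nat) :
  cfun f -> cfun g -> cfun (fun x => f x == g x).
Proof.
move=> cf cg; apply: (@cfun_ext _ _ (fun x => (f x <= g x)%N && (g x <= f x)%N)).
  by move=> x; rewrite eqn_leq.
exact: cfun_andb (cfun_leq cf cg) (cfun_leq cg cf).
Qed.

Lemma cfun_eq_bitseq (G : codedType) (f g : G -> bitseq) :
  cfun f -> cfun g -> cfun (fun x => f x == g x).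
Proof.
move=> cf cg; apply: (@cfun_ext _ _ (fun x => encode (f x) == encode (g x))).
  by move=> x; rewrite (inj_eq encode_bitseq_inj).
exact: cfun_eqn (cfun_encode cf) (cfun_encode cg).
Qed.

Lemma cfun_maxn (G : codedType) (f g : G -> nat) :
  cfun f -> cfun g -> cfun (fun x => maxn (f x) (g x)).
Proof.
move=> cf cg; apply: (@cfun_ext _ _ (fun x => (f x + (g x - f x))%N)).
  by move=> x; rewrite -maxnE.
exact: cfun_add cf (cfun_sub cg cf).
Qed.

(** * Computability of composite expressions and list operations *)

Ltac cfun_step :=
  first [ assumption | lazymatch goal with
  | |- cfun3 _ => unfold cfun3; cbv beta
  | |- cfun2 _ => unfold cfun2; cbv beta
  | |- cfun (fun x => x) => exact: cfun_id
  | |- cfun (fun _ => ?c) => exact: cfun_cst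
  | |- cfun (fun x => (_, _)) => apply: cfun_pair
  | |- cfun (fun x => _.1) => apply: cfun_fst
  | |- cfun (fun x => _.2) => apply: cfun_snd
  | |- cfun (fun x => _ :: _) => apply: cfun_cons
  | |- cfun (fun x => nat_of_bool _) => apply: cfun_nat_of_bool
  | |- cfun (fun x => if _ then _ else _) => apply: cfun_if
  | |- cfun (fun x => _ && _) => apply: cfun_andb
  | |- cfun (fun x => _ || _) => apply: cfun_orb
  | |- cfun (fun x => (_ + _)%N) => apply: cfun_add
  | |- cfun (fun x => (_ - _)%N) => apply: cfun_sub
  | |- cfun (fun x => (_.+1)%N) => apply: cfun_succ
  | |- cfun (fun x => leq _ _) => apply: cfun_leq
  | |- cfun (fun x => maxn _ _) => apply: cfun_maxn
  | |- cfun (fun x => foldr _ _ _) => apply: cfun_foldr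
  | |- cfun (fun x => iter _ _ _) => apply: cfun_iter
  | |- cfun (fun x => iteri _ _ _) => apply: cfun_iteri
  | |- cfun (fun x => _) => fail
  (* unification may have eta-reduced the function *)
  | |- cfun ?f => change (cfun (fun x => f x))
  end | match goal with
  | H : cfun ?f |- cfun (fun x => ?f _) => apply: (cfun_comp H)
  | H : cfun2 ?f |- cfun (fun x => ?f _ _) => apply: (cfun_app2 H)
  | H : cfun3 ?f |- cfun (fun x => ?f _ _ _) => apply: (cfun_app3 H)
  end ].
Ltac cfun_auto := repeat (cbv beta; cfun_step).

Lemma cfun_map (G A B : codedType) (h : G -> A -> B) (l : G -> seq A) :
  cfun2 h -> cfun l -> cfun (fun x => map (h x) (l x)).
Proof.
move=> ch cl; apply: (@cfun_ext _ _ (fun x => foldr (fun a s => h x a :: s) [::] (l x))).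
  by move=> x; elim: (l x) => //= a s ->.
by cfun_auto.
Qed.

Lemma cfun_cat (G A : codedType) (f g : G -> seq A) :
  cfun f -> cfun g -> cfun (fun x => f x ++ g x).
Proof.
move=> cf cg; apply: (@cfun_ext _ _ (fun x => foldr (fun a s => a :: s) (g x) (f x))).
  by move=> x; elim: (f x) => //= a s ->.
by cfun_auto.
Qed.

Lemma cfun_filter (G A : codedType) (p : G -> A -> bool) (l : G -> seq A) :
  cfun2 p -> cfun l -> cfun (fun x => [seq a <- l x | p x a]).
Proof.
move=> cp cl; apply: (@cfun_ext _ _
    (fun x => foldr (fun a s => if p x a then a :: s else s) [::] (l x))).
  by move=> x; elim: (l x) => //= a s ->.
by cfun_auto.
Qed.

Lemma cfun_has (G A : codedType) (p : G -> A -> bool) (l : G -> seq A) :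
  cfun2 p -> cfun l -> cfun (fun x => has (p x) (l x)).
Proof.
move=> cp cl; apply: (@cfun_ext _ _ (fun x => foldr (fun a b => p x a || b) false (l x))).
  by move=> x; elim: (l x) => //= a s ->.
by cfun_auto.
Qed.

Lemma cfun_find (G A : codedType) (p : G -> A -> bool) (l : G -> seq A) :
  cfun2 p -> cfun l -> cfun (fun x => find (p x) (l x)).
Proof.
move=> cp cl; apply: (@cfun_ext _ _
    (fun x => foldr (fun a n => if p x a then 0 else n.+1) 0 (l x))).
  by move=> x; elim: (l x) => //= a s ->.
by cfun_auto.
Qed.

Lemma cfun_size (G A : codedType) (l : G -> seq A) :
  cfun l -> cfun (fun x => size (l x)).
Proof.
move=> cl; apply: (@cfun_ext _ _ (fun x => foldr (fun _ n => n.+1) 0 (l x))).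
  by move=> x; elim: (l x) => //= a s ->.
by cfun_auto.
Qed.

Lemma cfun_nth (G A : codedType) (a0 : A) (l : G -> seq A) (n : G -> nat) :
  cfun l -> cfun n -> cfun (fun x => nth a0 (l x) (n x)).
Proof.
move=> cl cn; apply: (@cfun_ext _ _ (fun x =>
    if iter (n x) behead (l x) is a :: _ then a else a0)).
  move=> x; elim: (n x) (l x) => [|m IH] [|a s] //; rewrite iterSr /= ?IH//.
  by rewrite nth_nil.
apply: cfun_case; [by cfun_auto|by cfun_auto|].
apply: cfun_iter => //.
apply: (@cfun_ext _ _ (fun p : G * seq A => if p.2 is _ :: s then s else [::])).
  by case=> x [].
by apply: cfun_case; cfun_auto.
Qed.

Lemma cfun_iota (G : codedType) (m n : G -> nat) :
  cfun m -> cfun n -> cfun (fun x => iota (m x) (n x)).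
Proof.
move=> cm cn; apply: (@cfun_ext _ _
    (fun x => iteri (n x) (fun i s => s ++ [:: (m x + i)%N]) [::])).
  by move=> x; elim: (n x) => // k IH; rewrite -[in RHS]addn1 iotaD -IH.
apply: cfun_iteri; [|by []|exact: cfun_cst].
by cbv [cfun3]; apply: cfun_cat; cfun_auto.
Qed.

(* The arguments range over [nat], where every number is a code: on a number which is not
   a code the search might not terminate. *)
Lemma cfun_min (P : nat -> nat -> bool) (f : nat -> nat) : cfun2 P ->
  (forall x, P x (f x)) -> (forall x y, (y < f x)%N -> ~~ P x y) -> cfun f.
Proof.
move=> [p cp pE] Pf fmin; exists f => //.
apply: (@computable_min (fun y x => (1 - p (code_pair x y))%N)).
- apply: (recursive2_comp1 (g := fun n => (1 - n)%N)).
    exact: computable_comp2 recursive2_sub (computable_cst 1) computable_id.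
  exact: recursive2_comp1 cp (recursive2_swap recursive2_code_pair).
- by move=> x; have := pE (x, f x); rewrite encode_pair /= Pf => <-.
- move=> x y /fmin; have := pE (x, y); rewrite encode_pair /= => <-.
  by case: (P x y).
Qed.

Lemma cfun_computable (A : codedType) (f : nat -> A) :
  cfun f <-> computable (fun i => encode (f i)).
Proof.
split=> [[g cg gE]|cf]; first exact: computable_ext (fun x => esym (gE x)) cg.
by exists (fun i => encode (f i)).
Qed.

(** * Measure of a finite union of cylinders *)

Section CylinderMeasure.
Import Order.TTheory GRing.Theory Num.Theory.
Local Open Scope classical_set_scope.
Local Open Scope ring_scope.
Variable R : realType.

(** A cylinder is the trace on [[0, 1[] of a half-open dyadic interval. *)
Lemma measurable_cylinder (s : bitseq) : measurable
  (`[0, 1[ `&` binary_digits @^-1` [set X | prefix_of X (size s) = s] : set R).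
Proof.
pose v := bits_val s; pose p : R := 2 ^+ size s.
have p0 : 0 < p by rewrite exprn_gt0.
suff -> : `[0, 1[ `&` binary_digits @^-1` [set X | prefix_of X (size s) = s] =
    `[0, 1[ `&` `[v%:R / p, v.+1%:R / p[ :> set R.
  by apply: measurableI; exact: measurable_itv.
apply/seteqP; split => x [x01] /=; have := x01; rewrite /= !in_itv /= => x01'.
  move=> /(prefix_of_binary_digits _ x01') h; split => //.
  rewrite ler_pdivrMr// ltr_pdivlMr// /v -h /p; apply: truncn_itv.
  by case/andP: x01' => x0 _; rewrite mulr_ge0// ltW.
rewrite ler_pdivrMr// ltr_pdivlMr// => h; split => //.
by apply/prefix_of_binary_digits => //; exact: truncn_def.
Qed.

Lemma cantor_lebesgue_cylinders n (L : seq bitseq) :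
  {in L, forall s, size s = n} -> uniq L ->
  cantor_lebesgue R [set X | prefix_of X n \in L] = ((size L)%:R * 2 ^- n)%:E.
Proof.
rewrite /cantor_lebesgue.
pose C (L : seq bitseq) := `[0, 1[ `&` binary_digits @^-1` [set X | prefix_of X n \in L] : set R.
(* Measurability is carried along the induction, since additivity of the measure on disjoint sets
   requires it. *)
suff : {in L, forall s, size s = n} -> uniq L ->
  measurable (C L) /\ lebesgue_measure (C L) = ((size L)%:R * 2 ^- n)%:E.
  by move=> h /h{}h /h[].
elim: L => [_ _|s L IH sz /= /andP[sL uL]].
  suff -> : C [::] = set0 by rewrite measure0 mul0r; split.
  by apply/seteqP; split => x //= [].
have [|mL muL] := IH _ uL; first by move=> t tL; apply: sz; rewrite in_cons tL orbT.
have ssz : size s = n by apply: sz; rewrite mem_head.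
pose S := `[0, 1[ `&` binary_digits @^-1` [set X | prefix_of X (size s) = s] : set R.
have -> : C (s :: L) = S `|` C L.
  apply/seteqP; rewrite /C /S; split => x /=; rewrite in_cons ssz.
    by move=> [x01 /orP[/eqP|]]; [left|right].
  by move=> [[x01 ->]|[x01 ->]]; split => //; rewrite ?eqxx ?orbT.
split; first by apply: measurableU => //; exact: measurable_cylinder.
transitivity (lebesgue_measure S + lebesgue_measure (C L))%E.
  apply: measureU => //; first exact: measurable_cylinder.
  apply/seteqP; rewrite /C /S; split => x //= -[[_ xs] [_]]; rewrite -ssz xs.
  by rewrite (negbTE sL).
rewrite muL [lebesgue_measure S](cantor_lebesgue_cylinder R s) -EFinD ssz.
by rewrite -[in RHS]natr1 mulrDl mul1r addrC.
Qed.

End CylinderMeasure.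

(** * Truth tables *)

Ltac cfun_list_step := first [ cfun_step | lazymatch goal with
  | |- cfun (fun x => map _ _) => apply: cfun_map
  | |- cfun (fun x => _ ++ _) => apply: cfun_cat
  | |- cfun (fun x => seq.filter _ _) => apply: cfun_filter
  | |- cfun (fun x => has _ _) => apply: cfun_has
  | |- cfun (fun x => _ == _ :> bitseq) => apply: cfun_eq_bitseq
  | |- cfun (fun x => find _ _) => apply: cfun_find
  | |- cfun (fun x => size _) => apply: cfun_size
  | |- cfun (fun x => nth _ _ _) => apply: cfun_nth
  | |- cfun (fun x => iota _ _) => apply: cfun_iota
  end ].
Ltac cfun_list_auto := repeat (cbv beta; cfun_list_step).

Lemma cfun_index (G : codedType) (s : G -> bitseq) (l : G -> seq bitseq) :
  cfun s -> cfun l -> cfun (fun x => index (s x) (l x)).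
Proof.
move=> cs cl; apply: (@cfun_ext _ _ (fun x => find (fun t => t == s x) (l x))) => //.
by cfun_list_auto.
Qed.

(** The order is lexicographic; ranks in this list later serve to name covered strings. *)
Definition bitseqs (n : nat) : seq bitseq :=
  iter n (fun l => map (cons false) l ++ map (cons true) l) [:: [::]].

Lemma mem_bitseqs n (z : bitseq) : (z \in bitseqs n) = (size z == n).
Proof.
have cI b : injective (cons b : bitseq -> bitseq) by move=> s t [].
have cF b b' (s : bitseq) l : b != b' -> (b :: s \in map (cons b') l) = false.
  by move=> bb'; apply/mapP => -[t _ [e]]; rewrite e eqxx in bb'.
elim: n z => [|n IH] [|b z]; rewrite /= ?mem_cat //.
  by apply/negbTE; rewrite negb_or; apply/andP; split; apply/mapP => -[].
by rewrite eqSS -IH; case: b; rewrite (mem_map (cI _)) cF// orbF.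
Qed.

Lemma uniq_bitseqs n : uniq (bitseqs n).
Proof.
have cI b : injective (cons b : bitseq -> bitseq) by move=> s t [].
elim: n => //= n IH; rewrite cat_uniq !(map_inj_uniq (cI _)) IH andbT.
by apply/hasPn => z /mapP[s _ ->]; apply/mapP => -[].
Qed.

Lemma size_bitseqs n : size (bitseqs n) = (2 ^ n)%N.
Proof. by elim: n => //= n IH; rewrite size_cat !size_map IH expnS mul2n addnn. Qed.

Lemma cfun_bitseqs : cfun bitseqs.
Proof. by rewrite /bitseqs; apply: cfun_iter; cfun_list_auto. Qed.

Section TruthTables.
Variable Phi : tt_reduction.

(** The pair of fields has the same code as the truth table, and unlike the record it lives in a
    coded type. *)
Lemma cfun_tt_table : cfun (fun i => (tt_queries (Phi i), tt_rows (Phi i))).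
Proof.
apply/cfun_computable; apply: computable_ext (tt_computable Phi) => i.
by rewrite /encode /= {1}/encode /= map_id.
Qed.

Lemma cfun_tt_use : cfun (tt_use Phi).
Proof.
pose T i := (tt_queries (Phi i), tt_rows (Phi i)).
have cT : cfun T := cfun_tt_table.
apply: (@cfun_ext _ _ (fun n =>
    (foldr (fun i m => maxn (foldr maxn 0 (T i).1) m) 0 (iota 0 n)).+1)).
  move=> n; rewrite /tt_use -(big_mkord xpredT (tt_use_at Phi)) /index_iota subn0.
  congr _.+1; elim: (iota 0 n) => [|i s IH]; rewrite ?big_nil// big_cons -IH /=.
  rewrite /tt_use_at; congr maxn.
  by elim: (tt_queries _) => [|a q IHq]; rewrite ?big_nil// big_cons -IHq.
by cfun_list_auto.
Qed.

(** The oracle [nth false z] extends the finite string [z] by zeros, so a table can be evaluated on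
    it from finite data. *)
Lemma cfun_tt_apply (G : codedType) (z : G -> bitseq) (i : G -> nat) :
  cfun z -> cfun i -> cfun (fun x => tt_apply Phi (nth false (z x)) (i x)).
Proof.
move=> cz ci; pose T j := (tt_queries (Phi j), tt_rows (Phi j)).
have cT : cfun T := cfun_tt_table.
apply: (@cfun_ext _ _ (fun x =>
    has (fun r => r == map (nth false (z x)) (T (i x)).1) (T (i x)).2)).
  by move=> x; rewrite /tt_apply /tt_value -has_pred1.
by cfun_list_auto.
Qed.

Lemma tt_value_ext t Z Z' : {in tt_queries t, Z =1 Z'} -> tt_value t Z = tt_value t Z'.
Proof. by move=> /eq_in_map e; rewrite /tt_value e. Qed.

Lemma tt_use_gt i n p : (i < n)%N -> p \in tt_queries (Phi i) -> (p < tt_use Phi n)%N.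
Proof.
move=> ltin pq; rewrite ltnS.
apply: leq_trans _ (leq_bigmax (F := fun i : 'I_n => tt_use_at Phi i) (Ordinal ltin)).
exact: (@leq_bigmax_seq _ _ xpredT id).
Qed.

(** The use principle: all positions queried for some [i < n] lie below [tt_use Phi n], so the
    padding is never read. *)
Lemma prefix_of_tt_apply Y n : prefix_of (tt_apply Phi Y) n =
  prefix_of (tt_apply Phi (nth false (prefix_of Y (tt_use Phi n)))) n.
Proof.
apply/eq_in_map => i; rewrite mem_iota add0n => /= ltin.
apply: tt_value_ext => p pq; rewrite nth_mkseq//; exact: tt_use_gt pq.
Qed.

End TruthTables.

(** * Kurtz randomness bounds the use from below *)

Section RandomImpliesUse.
Import Order.TTheory GRing.Theory Num.Theory.
Local Open Scope classical_set_scope.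
Local Open Scope ring_scope.

Lemma kurtz_random_tt_use (R : realType) X Y (Phi : tt_reduction) :
  kurtz_random R X -> tt_apply Phi Y = X ->
  exists c, forall n, (n - c <= tt_use Phi n)%N.
Proof.
move=> rX YX; apply: contrapT => noc; apply: rX.
pose P c n := (tt_use Phi n < n - c)%N.
have exP c : exists n, P c n.
  apply: contrapT => noP; apply: noc; exists c => n.
  by rewrite leqNgt; apply/negP => h; apply: noP; exists n.
pose N c := ex_minn (exP c).
have PN c : P c (N c) by rewrite /N; case: ex_minnP.
have cU := cfun_tt_use Phi.
have cN : cfun N.
  apply: (@cfun_min P) => // [|c n].
    by rewrite /P; cfun_list_auto.
  by rewrite /N; case: ex_minnP => m _ min; apply: contraTN => /min; rewrite -leqNgt.
(* All possible values of the first [N c] output bits, one for each oracle string of length the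
   use. *)
pose D c := [seq prefix_of (tt_apply Phi (nth false z)) (N c) | z <- bitseqs (tt_use Phi (N c))].
exists D; split; last first.
  move=> c; exists (N c); rewrite -YX prefix_of_tt_apply.
  by apply: map_f; rewrite mem_bitseqs size_mkseq.
split.
  apply/(@cfun_computable (coded_seq (coded_seq coded_bool))).
  have cB := cfun_bitseqs.
  rewrite /D /prefix_of /mkseq.
  by cfun_list_auto; apply: cfun_tt_apply; cfun_list_auto.
move=> c.
have szD : {in D c, forall s, size s = N c} by move=> s /mapP[z _ ->]; rewrite size_mkseq.
(* All members have length [N c], so only that prefix matters; duplicates are removed because the
   measure counts distinct strings. *)
have -> : [set Z | has_prefix_in Z (D c)] = [set Z | prefix_of Z (N c) \in undup (D c)].
  apply/seteqP; split => Z /=; rewrite mem_undup.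
    by move=> [n nD]; have := szD _ nD; rewrite size_mkseq => <-.
  by exists (N c).
rewrite cantor_lebesgue_cylinders ?undup_uniq//; last first.
  by move=> s; rewrite mem_undup; exact: szD.
rewrite lee_fin ler_pdivrMr ?exprn_gt0//.
(* The strict inequality in [P] rules out truncation in [N c - c]. Hence at most [2 ^ (N c - c)]
   strings of length [N c] occur. *)
have Pc : (tt_use Phi (N c) + c <= N c)%N by have := PN c; rewrite /P; lia.
have cN' : (c <= N c)%N by lia.
rewrite -[in leRHS](subnK cN') exprD mulrCA mulVf ?expf_neq0// mulr1 -natrX ler_nat.
apply: leq_trans (size_undup _) _; rewrite size_map size_bitseqs leq_exp2l//; lia.
Qed.

End RandomImpliesUse.

(** * Coding a sequence caught by a Kurtz test *)

Lemma block_concat (w : nat -> bitseq) (u : nat -> nat) :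
  (forall k, u k.+1 = (u k + size (w k))%N) -> (forall k, (0 < size (w k))%N) ->
  exists Y, forall k, map Y (iota (u k) (size (w k))) = w k.
Proof.
move=> uS w0.
have homo_u : {homo u : i j / (i <= j)%N}.
  by apply: homo_leq => [//|????|i]; [exact: leq_trans|rewrite uS leq_addr].
have u_ge k : (k <= u k)%N.
  by elim: k => // k IH; rewrite uS; have := w0 k; lia.
have exK p : exists k, (p < u k.+1)%N by exists p; exact: u_ge.
pose K p := ex_minn (exK p).
(* [K p] is the block containing [p]: blocks are nonempty, so the starts are unbounded, and the
   least [k] with [p < u k.+1] exists. *)
exists (fun p => nth false (w (K p)) (p - u (K p))) => k.
rewrite -{1}[u k]addn0 iotaDl -map_comp -[RHS](mkseq_nth false) /mkseq.
apply/eq_in_map => t; rewrite mem_iota add0n => /= ltt.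
suff -> : K (u k + t)%N = k by rewrite addKn.
rewrite /K; case: ex_minnP => m lem minm; apply/eqP; rewrite eqn_leq.
rewrite minm ?uS ?ltn_add2l//= leqNgt; apply/negP => /homo_u; lia.
Qed.

Section CoverCoding.
Variable D : nat -> seq bitseq.

(** The sum is a crude bound on the length of every member of [D i]; the successor keeps blocks
    nonempty. *)
Definition block_size (i : nat) : nat := (sumn (map size (D i))).+1.
Definition cover_level (i : nat) : nat := (i + block_size i)%N.
(** Compares [t] with the first [size t] bits of [s]. At length [cover_level i] the default [false]
    is never reached, by [leq_size_level]. *)
Definition extends_in (E : seq bitseq) (s : bitseq) : bool :=
  has (fun t => t == mkseq (nth false s) (size t)) E.
Definition cover_strings (i : nat) : seq bitseq :=
  [seq s <- bitseqs (cover_level i) | extends_in (D i) s].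

Lemma leq_size_level i t : t \in D i -> (size t <= cover_level i)%N.
Proof.
move=> tD; suff : (size t <= sumn (map size (D i)))%N.
  by rewrite /cover_level /block_size; lia.
by elim: (D i) tD => //= a s IH; rewrite in_cons => /orP[/eqP ->|/IH]; lia.
Qed.

Lemma mem_cover_strings X i :
  (prefix_of X (cover_level i) \in cover_strings i) <-> has_prefix_in X (D i).
Proof.
rewrite mem_filter mem_bitseqs size_mkseq eqxx andbT.
have nthX t : t \in D i ->
    mkseq (nth false (prefix_of X (cover_level i))) (size t) = prefix_of X (size t).
  move=> tD; apply/eq_in_map => k; rewrite mem_iota add0n => /= ltk.
  by rewrite nth_mkseq// (leq_trans ltk)// leq_size_level.
split=> [/hasP[t tD /eqP et]|[n nD]].
  by exists (size t); rewrite -nthX// -et.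
by apply/hasP; exists (prefix_of X n) => //; rewrite nthX// size_mkseq.
Qed.

Lemma uniq_cover_strings i : uniq (cover_strings i).
Proof. exact: filter_uniq (uniq_bitseqs _). Qed.

(** The argument [block_start k' + k] is [block_index k'] written out, since [k = k'.+1]. *)
Fixpoint block_start (k : nat) : nat :=
  if k is k'.+1 then (block_start k' + block_size (block_start k' + k))%N else 0.
Definition block_index (k : nat) : nat := (block_start k + k.+1)%N.
Definition block_level (k : nat) : nat := cover_level (block_index k).

Lemma block_startS k :
  block_start k.+1 = (block_start k + block_size (block_index k))%N.
Proof. by []. Qed.

(** The gain of the coding: the oracle bits before [block_start k.+1] will give [k.+1] more bits of
    [X] than their own number. *)
Lemma block_levelE k : block_level k = (block_start k.+1 + k.+1)%N.
Proof. rewrite /block_level /cover_level block_startS /block_index; lia. Qed.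

Lemma ex_block j : exists k, (j < block_level k)%N.
Proof. by exists j; rewrite block_levelE; lia. Qed.
Definition block_of (j : nat) : nat := ex_minn (ex_block j).

(** A covered string and its name have the same rank in [cover_strings i] and
    [bitseqs (block_size i)]. Names of too large a rank decode to the empty string. *)
Definition decode_block (i : nat) (z : bitseq) : bitseq :=
  nth [::] (cover_strings i) (index z (bitseqs (block_size i))).
Definition encode_block (i : nat) (s : bitseq) : bitseq :=
  nth [::] (bitseqs (block_size i)) (index s (cover_strings i)).

(** Reads exactly the first block whose decoded string is long enough to contain bit [j], and
    accepts the names for which that bit is true. *)
Definition block_table (j : nat) : truth_table :=
  let k := block_of j in let i := block_index k in
  TruthTable (iota (block_start k) (block_size i))
    [seq z <- bitseqs (block_size i) | nth false (decode_block i z) j].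

Lemma computable_block_table :
  computable (fun i => code_strings (D i)) ->
  computable (fun j => code_tt (block_table j)).
Proof.
move=> compD.
have cD : cfun D := (@cfun_computable (coded_seq (coded_seq coded_bool)) D).2 compD.
have cB := cfun_bitseqs.
have cS : cfun block_size.
  apply: (@cfun_ext _ _ (fun i => (foldr (fun t n => size t + n)%N 0 (D i)).+1)).
    by move=> i; rewrite /block_size; elim: (D i) => //= t E [->].
  by cfun_list_auto.
have cL : cfun cover_level by rewrite /cover_level; cfun_list_auto.
have cC : cfun cover_strings by rewrite /cover_strings /extends_in /mkseq; cfun_list_auto.
have cu : cfun block_start.
  apply: (@cfun_ext _ _ (fun k =>
      iteri k (fun k u => u + block_size (u + k.+1))%N 0)).
    by elim=> //= k ->.
  by cfun_list_auto.
have ci : cfun block_index by rewrite /block_index; cfun_list_auto.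
have cl : cfun block_level by rewrite /block_level; cfun_list_auto.
have ck : cfun block_of.
  apply: (@cfun_min (fun j k => j < block_level k)%N) => [|j|j k].
  - by cfun_list_auto.
  - by rewrite /block_of; case: ex_minnP.
  - by rewrite /block_of; case: ex_minnP => m _ min; apply: contraTN => /min; rewrite -leqNgt.
have cd : cfun2 decode_block.
  by rewrite /decode_block; cfun_list_auto; apply: cfun_index; cfun_list_auto.
have cT : cfun (fun j => (tt_queries (block_table j), tt_rows (block_table j))).
  by cbv [block_table tt_queries tt_rows]; cfun_list_auto.
move/cfun_computable: cT; apply: computable_ext => j.
rewrite encode_pair /code_tt /code_pair -[0]/(CodeSeq.code [::]) -!code_consE.
by rewrite /encode /= map_id.
Qed.

End CoverCoding.

(** * Counting the covered strings *)

Section CoverMeasure.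
Import Order.TTheory GRing.Theory Num.Theory.
Local Open Scope classical_set_scope.
Local Open Scope ring_scope.

(** The covered strings have total measure their number times [2^-(i + block_size i)], which the
    test bounds by [2^-i]. *)
Lemma size_cover_strings (R : realType) D i :
  kurtz_test R D -> (size (cover_strings D i) <= 2 ^ block_size D i)%N.
Proof.
move=> [_ /(_ i)].
have -> : [set Z | has_prefix_in Z (D i)] =
    [set Z | prefix_of Z (cover_level D i) \in cover_strings D i].
  by apply/seteqP; split => Z /= /mem_cover_strings.
rewrite cantor_lebesgue_cylinders ?uniq_cover_strings//; last first.
  by move=> s; rewrite mem_filter mem_bitseqs => /andP[_ /eqP].
rewrite lee_fin ler_pdivrMr ?exprn_gt0// /cover_level exprD mulrA mulVf ?expf_neq0//.
by rewrite mul1r -natrX ler_nat.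
Qed.

End CoverMeasure.

Lemma size_encode_block D i s : (size (cover_strings D i) <= 2 ^ block_size D i)%N ->
  s \in cover_strings D i -> size (encode_block D i s) = block_size D i.
Proof.
move=> sz sC; apply/eqP; rewrite -mem_bitseqs mem_nth// size_bitseqs.
by apply: leq_trans sz; rewrite index_mem.
Qed.

(** The size bound puts the rank of [s] within [bitseqs], whose lack of repetitions makes the rank
    recoverable from the name. *)
Lemma encode_blockK D i s : (size (cover_strings D i) <= 2 ^ block_size D i)%N ->
  s \in cover_strings D i -> decode_block D i (encode_block D i s) = s.
Proof.
move=> sz sC; rewrite /decode_block index_uniq ?uniq_bitseqs ?nth_index//.
by rewrite size_bitseqs; apply: leq_trans sz; rewrite index_mem.
Qed.

(** * A reduction of small use from a failed Kurtz test *)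

Lemma tt_use_kurtz_random (R : realType) X :
  (forall Y (Phi : tt_reduction), tt_apply Phi Y = X ->
     exists c, forall n, (n - c <= tt_use Phi n)%N) ->
  kurtz_random R X.
Proof.
move=> useX [D [testD XD]].
pose w k := encode_block D (block_index D k) (prefix_of X (block_level D k)).
have sz i := size_cover_strings i testD.
have XC k : prefix_of X (block_level D k) \in cover_strings D (block_index D k).
  exact/mem_cover_strings.
have sw k : size (w k) = block_size D (block_index D k) by exact: size_encode_block.
have [k|k|Y YE] := @block_concat w (block_start D).
- by rewrite sw.
- by rewrite sw.
pose Phi := TTReduction (computable_block_table testD.1).
have jk j : (j < block_level D (block_of D j))%N by rewrite /block_of; case: ex_minnP.
have PhiY : tt_apply Phi Y = X.
  apply/funext => j; rewrite /tt_apply /tt_value.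
  (* The answers to the queries form the block [w (block_of j)], which decodes to a prefix of [X]
     longer than [j]. *)
  cbv [Phi tt_table block_table tt_queries tt_rows]; rewrite -[in iota _ _]sw YE.
  rewrite mem_filter mem_bitseqs sw eqxx andbT.
  by rewrite encode_blockK// nth_mkseq.
have [c useP] := useX Y Phi PhiY.
(* At [n = block_level D c] one has [n - c = block_start D c.+1 + 1], so this bound contradicts the
   choice of [c]. *)
suff : (tt_use Phi (block_level D c) <= block_start D c.+1)%N.
  by have := useP (block_level D c); rewrite block_levelE; lia.
have u_mono : {homo block_start D : i j / (i <= j)%N}.
  by apply: homo_leq => [//|????|i]; [exact: leq_trans|rewrite block_startS leq_addr].
have u0 : (0 < block_start D c.+1)%N by rewrite block_startS /block_size; lia.
rewrite /tt_use -[X in (_ <= X)%N](prednK u0) ltnS.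
apply/bigmax_leqP => -[j ltj] _; apply/bigmax_leqP_seq => p + _.
cbv [Phi tt_table block_table tt_queries nat_of_ord].
rewrite mem_iota -block_startS => /andP[_ ltp].
(* Since [j < block_level D c], minimality of [block_of] keeps all queries within the blocks up to
   [c]. *)
have lec : (block_of D j <= c)%N by rewrite /block_of; case: ex_minnP => m _; exact.
by rewrite -ltnS prednK// (leq_trans ltp)// u_mono.
Qed.

Theorem theorem1p5 (R : realType) (X : nat -> bool) :
  kurtz_random R X <->
  (forall (Y : nat -> bool) (Phi : tt_reduction),
     tt_apply Phi Y = X ->
     exists c : nat, forall n : nat, (n - c <= tt_use Phi n)%N).
Proof.
split; last exact: tt_use_kurtz_random.
by move=> rX Y Phi; exact: kurtz_random_tt_use rX.
Qed.
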